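(* Let $\kappa_T(K_n)$ denote the translative kissing number of the $n$-dimensional cross-polytope $K_n$. Then $$\kappa_T(K_n)\geq 1.1637^{(1-o(1))n}\quad\text{as } n\to\infty,$$ i.e., there is a real sequence $(\varepsilon_n)_{n\ge 1}$ with $\varepsilon_n\to 0$ such that $\kappa_T(K_n)\geq 1.1637^{(1-\varepsilon_n)n}$ for all $n\geq 1$.
   Context: The cross-polytope is $K_n=\{x\in\mathbb{R}^n:\sum_{i=1}^n|x_i|\leq 1\}$, the unit ball of the norm $\|x\|_1=\sum_{i=1}^n|x_i|$. A kissing configuration of $K_n$ is a set $S\subset\mathbb{R}^n$ such that the translates $x+\frac12 K_n$ ($x\in S$) have pairwise disjoint interiors and each $x+\frac12 K_n$ intersects $\frac12 K_n$ only at its boundary (touching it); equivalently, $\|x\|_1=1$ for all $x\in S$ and $\|x-x'\|_1\geq 1$ for all distinct $x,x'\in S$. The translative kissing number $\kappa_T(K_n)$ is the maximum cardinality of a kissing configuration of $K_n$. *)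

(* Defs.v *)
From HB Require Import structures.
From mathcomp Require Import all_boot all_order all_algebra.
From mathcomp Require Import all_classical all_reals all_analysis.

Set Implicit Arguments.
Unset Strict Implicit.
Unset Printing Implicit Defensive.

Import Order.TTheory GRing.Theory Num.Theory.
Import numFieldNormedType.Exports.

Local Open Scope classical_set_scope.
Local Open Scope card_scope.
Local Open Scope ring_scope.

(* The library norm on 'rV[R]_n is the sup norm; it induces the usual topology
   of R^n, which is the one used below for interior and closure. *)
Definition norm_l1 (R : realType) (n : nat) (x : 'rV[R]_n) : R :=
  \sum_(i < n) `|x ord0 i|.

Definition cross_polytope (R : realType) (n : nat) : set 'rV[R]_n :=
  [set x | norm_l1 x <= 1].
Arguments cross_polytope : clear implicits.

(* x + K/2 *)
Definition half_translate (R : realType) (n : nat) (K : set 'rV[R]_n)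
    (x : 'rV[R]_n) : set 'rV[R]_n :=
  [set x + 2^-1 *: y | y in K].

Definition boundary (T : topologicalType) (A : set T) : set T :=
  closure A `\` interior A.

Definition kissing_configuration (R : realType) (n : nat)
    (K : set 'rV[R]_n) (S : set 'rV[R]_n) : Prop :=
  trivIset S (fun x => interior (half_translate K x)) /\
  forall x, S x ->
    half_translate K x `&` half_translate K 0 !=set0 /\
    half_translate K x `&` half_translate K 0 `<=`
      boundary (half_translate K 0).

Definition is_max_kissing (R : realType) (n : nat) (K : set 'rV[R]_n)
    (k : nat) : Prop :=
  (exists S, kissing_configuration K S /\ S #= `I_k) /\
  forall S, kissing_configuration K S -> S #<= `I_k.

(* The value is 0 if the maximum does not exist. *)
Definition kissing_number (R : realType) (n : nat) (K : set 'rV[R]_n) : nat :=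
  xget 0%N [set k | is_max_kissing K k].

(* Main.v *)
Require Import Defs.
From HB Require Import structures.
From mathcomp Require Import all_boot all_order all_algebra.
From mathcomp Require Import all_classical all_reals all_analysis.
From mathcomp Require Import ring lra zify.

Set Implicit Arguments.
Unset Strict Implicit.
Unset Printing Implicit Defensive.

Import Order.TTheory GRing.Theory Num.Theory.
Import numFieldNormedType.Exports.
Local Open Scope classical_set_scope.
Local Open Scope card_scope.
Local Open Scope ring_scope.

(** A code of words over a finite set of integers, all of l1 norm m and at
    mutual l1 distance at least m, becomes a kissing configuration of the
    cross-polytope after division by m.  So it suffices to find, for some m, an
    exponentially large code, and this is done by a weighted
    Gilbert-Varshamov argument.

    Join two words of norm m when their distance is less than m.  A graph with
    positive vertex weights W has an independent set of size at least the sum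
    of W(x) / W(N[x]) over its vertices x, N[x] being the closed neighbourhood
    ([weighted_caro_wei]).  Take W(x) = w(x_1) ... w(x_n).  For 0 < t <= 1,
    every y in N[x] satisfies t^m <= t^|x-y|, and the sum of W(y) t^|x-y| over
    all words y is the product of the Z(x_i), where
    Z(a) = sum_b w(b) t^|a-b| ([ball_weight_le]).  Since t^m = t^|x|, the code
    of norm m has at least
      sum over the words x of norm m of
        prod_i w(x_i) t^|x_i| / Z(x_i)
    words ([exists_code]).  Summing over the linearly many values of m gives a
    sum over all words, which factors as the n-th power of
      c = sum_a w(a) t^|a| / Z(a);
    hence c^n is at most the kissing number times a linear function of n
    ([kissing_number_growth]).  With the letters -2, ..., 2, the weight 4 on 0
    and 1 elsewhere, and t = 1/2, one gets c = 17176/14663 = 1.1713...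
    ([letter_rate]), and the linear factor is absorbed by the o(1)
    ([linear_factor_subexponential]).

    As the kissing number is a maximum that could fail to exist, one also needs
    that kissing configurations have bounded size; a grid of mesh 1/(n+1)
    separates their points ([kissing_configuration_card_le]). *)

(** * Independent sets in weighted graphs *)

(** Greedy choice: pick a vertex x of least closed-neighbourhood weight, keep
    it, and delete its neighbourhood N[x].  The deleted vertices contribute at
    most the sum over y in N[x] of w y / W(N[x]), which is 1, while the terms of
    the remaining vertices can only increase, since their neighbourhoods
    shrink. *)
Lemma weighted_caro_wei (R : realFieldType) (T : finType) (e : rel T)
    (w : T -> R) (V : {set T}) :
  reflexive e -> symmetric e -> (forall x, 0 < w x) ->
  exists C : {set T}, [/\ C \subset V,
    {in C &, forall x y, x != y -> ~~ e x y} &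
    \sum_(x in V) w x / (\sum_(y in V | e x y) w y) <= #|C|%:R].
Proof.
move=> erefl esym w0; have [k] := ubnP #|V|; elim: k V => // k IH V leVk.
have [->|[v vV]] := set_0Vmem V.
  exists finset.set0; split;
    [exact: finset.sub0set | by move=> x y; rewrite inE |].
  by rewrite big_set0 cards0.
pose W (U : {set T}) x := \sum_(y in U | e x y) w y.
have Wpos (U : {set T}) x : x \in U -> 0 < W U x.
  move=> xU; rewrite /W (bigD1 x) /=; last by rewrite xU erefl.
  by rewrite ltr_wpDr // sumr_ge0 // => y _; apply: ltW.
case: (@arg_minP _ R _ v (fun z => z \in V) (W V) vV) => x xV xmin.
pose U := [set y in V | ~~ e x y].
have UV : U \subset V by apply/fintype.subsetP => y; rewrite inE => /andP[].
have ltUk : (#|U| < k)%N.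
  rewrite -ltnS (leq_trans _ leVk) // ltnS; apply: proper_card.
  apply/properP; split=> //; exists x => //.
  by rewrite inE xV erefl.
have [C [CU Cind Csum]] := IH U ltUk.
have xC : x \notin C.
  by apply/negP => /(fintype.subsetP CU); rewrite inE erefl andbF.
have notadj y : y \in C -> ~~ e x y.
  by move=> /(fintype.subsetP CU); rewrite inE => /andP[].
exists (x |: C); split.
- by rewrite finset.subUset finset.sub1set xV (fintype.subset_trans CU UV).
- move=> y z; rewrite !inE => /orP[/eqP->|yC] /orP[/eqP->|zC].
  + by rewrite eqxx.
  + by move=> _; apply: notadj.
  + by move=> _; rewrite esym; apply: notadj.
  + exact: Cind.
rewrite cardsU1 xC add1n -natr1 addrC.
rewrite (bigID (e x)) /= lerD //; last first.
  apply: le_trans Csum.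
  rewrite [leRHS](eq_bigl (fun y => (y \in V) && ~~ e x y)); last first.
    by move=> y; rewrite inE.
  apply: ler_sum => y /andP[yV exy].
  have yU : y \in U by rewrite inE yV.
  apply: ler_wpM2l; first exact: ltW.
  rewrite lef_pV2 ?posrE; [|exact: Wpos..].
  rewrite /W [leRHS](bigID (mem U)) /= [X in _ <= X + _](eq_bigl
    (fun z => (z \in U) && e y z)); last first.
    move=> z; rewrite andbC andbA; congr andb.
    by case zU: (z \in U) => //=; rewrite (fintype.subsetP UV).
  by rewrite lerDl sumr_ge0 // => z _; apply: ltW.
apply: (@le_trans _ _ (\sum_(y in V | e x y) w y / W V x)).
  apply: ler_sum => y /andP[yV exy]; apply: ler_wpM2l; first exact: ltW.
  by rewrite lef_pV2 ?posrE; [apply: xmin|exact: Wpos..].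
by rewrite -mulr_suml -/(W V x) divff // gt_eqF // Wpos.
Qed.

(** * Codes in the l1 metric *)

Definition word_norm (A : finType) (pos : A -> int) n
    (x : {ffun 'I_n -> A}) : nat :=
  (\sum_i `|pos (x i)|)%N.

Definition word_dist (A : finType) (pos : A -> int) n (x y : {ffun 'I_n -> A}) :
    nat := (\sum_i `|(pos (x i) - pos (y i))%R|)%N.

(** One-letter factor of the generating function of all words, graded by their
    distance to a fixed word. *)
Definition local_weight (R : realFieldType) (A : finType) (pos : A -> int)
    (w : A -> R) (t : R) (a : A) : R :=
  \sum_b w b * t ^+ `|pos a - pos b|%N.

(** Markov-type bound: t ^ m <= t ^ d for d < m, and the sum over all words y
    of the product weight times t ^ (distance from x to y) factors over the
    coordinates. *)
Lemma ball_weight_le (R : realFieldType) (A : finType) (pos : A -> int)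
    (w : A -> R) (t : R) n m (x : {ffun 'I_n -> A}) :
  (forall a, 0 < w a) -> 0 < t <= 1 ->
  t ^+ m * (\sum_(y | (word_dist pos x y < m)%N) \prod_i w (y i))
    <= \prod_i local_weight pos w t (x i).
Proof.
move=> w0 /andP[t0 t1]; rewrite bigA_distr_bigA /=.
under [leRHS]eq_bigr do rewrite big_split /= -expr_sum -/(word_dist _ _ _).
rewrite mulr_sumr [leRHS](bigID (fun y => word_dist pos x y < m)%N) /=.
apply: ler_wpDr.
  apply: sumr_ge0 => y _; rewrite mulr_ge0 ?prodr_ge0 ?exprn_ge0 ?ltW //.
  by move=> i _; apply: ltW.
apply: ler_sum => y lt_m; rewrite mulrC ler_wpM2l ?prodr_ge0 //.
  by move=> i _; apply: ltW.
exact: (ler_wiXn2l (ltW t0) t1 (ltnW lt_m)).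
Qed.

(** The independent set given by [weighted_caro_wei] in the graph joining two
    words of norm m at distance less than m.  The factor t ^ m lost in
    [ball_weight_le] is t ^ (norm of x), and so is again a product over the
    coordinates. *)
Lemma exists_code (R : realFieldType) (A : finType) (pos : A -> int)
    (w : A -> R) (t : R) n m :
  (forall a, 0 < w a) -> 0 < t <= 1 -> (0 < m)%N ->
  exists C : {set {ffun 'I_n -> A}},
    [/\ {in C, forall x, word_norm pos x = m},
        {in C &, forall x y, x != y -> (m <= word_dist pos x y)%N} &
        \sum_(x : {ffun 'I_n -> A} | word_norm pos x == m)
          \prod_i (w (x i) * t ^+ `|pos (x i)|%N / local_weight pos w t (x i))
          <= #|C|%:R].
Proof.
move=> w0 t01 m0; have /andP[t0 _] := t01.
pose e (x y : {ffun 'I_n -> A}) := (word_dist pos x y < m)%N.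
pose W (x : {ffun 'I_n -> A}) := \prod_i w (x i).
have erefl : reflexive e.
  by move=> x; rewrite /e /word_dist big1 // => i _; rewrite subrr absz0.
have esym : symmetric e.
  move=> x y; rewrite /e /word_dist; congr (_ < _)%N.
  by apply: eq_bigr => i _; rewrite distnC.
have W0 x : 0 < W x by apply: prodr_gt0 => i _.
have [C [CV Cind Csum]] :=
  weighted_caro_wei [set x : {ffun 'I_n -> A} | word_norm pos x == m]%SET
    erefl esym W0.
exists C; split.
- by move=> x /(fintype.subsetP CV); rewrite inE => /eqP.
- by move=> x y xC yC /(Cind x y xC yC); rewrite -leqNgt.
apply: le_trans Csum; rewrite [leRHS](eq_bigl (fun x => word_norm pos x == m));
  last by move=> x; rewrite inE.
apply: ler_sum => x /eqP xm.
rewrite !big_split /= prodfV -expr_sum -/(word_norm pos x) xm -/(W x) -mulrA.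
rewrite ler_wpM2l ?(ltW (W0 x)) //.
set B := \sum_(y | _) W y.
have B0 : 0 < B.
  rewrite /B (bigD1 x) /=; last by rewrite inE xm eqxx erefl.
  by rewrite ltr_wpDr // sumr_ge0 // => y _; apply: ltW.
have Z0 : 0 < \prod_i local_weight pos w t (x i).
  apply: prodr_gt0 => i _; rewrite /local_weight (bigD1 (x i)) //=.
  rewrite ltr_wpDr ?mulr_gt0 ?exprn_gt0 // sumr_ge0 // => b _.
  by rewrite mulr_ge0 ?exprn_ge0 // ltW.
rewrite ler_pdivrMr // ler_pdivlMl // mulrC.
apply: le_trans (ball_weight_le pos m x w0 t01).
rewrite ler_wpM2l ?exprn_ge0 ?(ltW t0) //.
rewrite [leRHS](bigID (fun y => word_norm pos y == m)) /=.
rewrite ler_wpDr //; first by apply: sumr_ge0 => y _; apply: ltW (W0 y).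
rewrite le_eqVlt; apply/orP; left; apply/eqP.
by apply: eq_bigl => y; rewrite inE andbC.
Qed.

(** * Kissing configurations of the cross-polytope *)

Lemma norm_l1D (R : realType) n (x y : 'rV[R]_n) :
  norm_l1 (x + y) <= norm_l1 x + norm_l1 y.
Proof.
by rewrite -big_split; apply: ler_sum => i _; rewrite mxE ler_normD.
Qed.

Lemma norm_l1Z (R : realType) n (a : R) (x : 'rV[R]_n) :
  norm_l1 (a *: x) = `|a| * norm_l1 x.
Proof.
by rewrite mulr_sumr; apply: eq_bigr => i _; rewrite mxE normrM.
Qed.

Lemma norm_l1N (R : realType) n (x : 'rV[R]_n) : norm_l1 (- x) = norm_l1 x.
Proof. by rewrite -scaleN1r norm_l1Z normrN1 mul1r. Qed.

Lemma half_translateE (R : realType) n (x : 'rV[R]_n) :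
  half_translate (cross_polytope R n) x = [set z | norm_l1 (z - x) <= 2^-1].
Proof.
apply/seteqP; split=> z /=.
  move=> [y /= y1 <-]; rewrite addrC addKr norm_l1Z ger0_norm //.
  by rewrite -[leRHS]mulr1 ler_wpM2l.
move=> zx; exists (2 *: (z - x)).
  rewrite /cross_polytope /= norm_l1Z ger0_norm // mulrC.
  by rewrite -ler_pdivlMr // mul1r.
by rewrite scalerA mulVf // scale1r addrC subrK.
Qed.

(** A point z of the ball with l1 distance 1/2 from x is not interior, since
    moving it slightly away from x leaves the ball; a point at smaller distance
    is interior because a sup-norm perturbation by r changes the l1 norm by at
    most n * r. *)
Lemma interior_half_translate (R : realType) n (x : 'rV[R]_n) :
  interior (half_translate (cross_polytope R n) x) =
  [set z | norm_l1 (z - x) < 2^-1].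
Proof.
rewrite half_translateE; apply/seteqP; split=> z /=.
  case/nbhs_ballP => e /= e0 zball; rewrite lt_neqAle.
  have -> /= : norm_l1 (z - x) <= 2^-1 by apply: zball; exact: ballxx.
  rewrite andbT; apply/eqP => zx.
  (* M dominates the entries of z - x, so d * (z - x) is smaller than e in the
     sup norm. *)
  pose M := 1 + \sum_(i < n) `|(z - x) ord0 i|.
  have M0 : 0 < M by rewrite ltr_pwDl // sumr_ge0.
  pose d := e / 2 / M.
  have d0 : 0 < d by rewrite !divr_gt0.
  have /zball /= : ball z e (z + d *: (z - x)).
    split; first exact: e0.
    move=> i j; rewrite /ball /= /ball_ mxE opprD addrA subrr add0r normrN mxE.
    rewrite normrM gtr0_norm // /d mulrAC ltr_pdivrMr //.
    have -> : i = ord0 by rewrite ord1.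
    have le_M : `|(z - x) ord0 j| < M.
      rewrite /M (bigD1 j) //= addrCA ltrDl ltr_pwDl //.
      exact: sumr_ge0.
    have := normr_ge0 ((z - x) ord0 j); nra.
  have -> : z + d *: (z - x) - x = (1 + d) *: (z - x).
    by rewrite scalerDl scale1r addrAC.
  rewrite norm_l1Z zx gtr0_norm ?addr_gt0 //.
  apply/negP; rewrite -ltNge ltr_pMl //; lra.
move=> zx; apply/nbhs_ballP.
exists ((2^-1 - norm_l1 (z - x)) / n.+1%:R) => /=.
  by rewrite divr_gt0 // subr_gt0.
move=> y /= [_ zy].
have -> : y - x = (z - x) - (z - y) by rewrite opprB [RHS]addrC addrA subrK.
apply: le_trans (norm_l1D _ _) _; rewrite norm_l1N -lerBrDl.
set g := _ - _ in zy *.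
have g0 : 0 < g by rewrite subr_gt0.
apply: (@le_trans _ _ (\sum_(i < n) g / n.+1%:R)).
  apply: ler_sum => i _; have := zy ord0 i.
  by rewrite /ball /= /ball_ !mxE => /ltW.
rewrite sumr_const card_ord -[leLHS]mulr_natr -mulrA ger_pMr // mulrC.
by rewrite ler_pdivrMr // mul1r ler_nat.
Qed.

Lemma norm_l1_dist (R : realType) n (x y z : 'rV[R]_n) :
  norm_l1 (x - y) <= norm_l1 (z - x) + norm_l1 (z - y).
Proof.
have -> : x - y = (z - y) - (z - x) by rewrite opprB [RHS]addrC addrA subrK.
by rewrite addrC (le_trans (norm_l1D _ _)) // norm_l1N.
Qed.

Lemma norm_l1_0 (R : realType) n : norm_l1 (0 : 'rV[R]_n) = 0.
Proof. by rewrite -(scale0r 0) norm_l1Z normr0 mul0r. Qed.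

(** Both conditions follow from the triangle inequality once interiors are
    described by the l1 norm.  The touching point of x + K/2 and K/2 is x/2. *)
Lemma kissing_configuration_of_sep (R : realType) n (S : set 'rV[R]_n) :
  (forall x, S x -> norm_l1 x = 1) ->
  (forall x y, S x -> S y -> x != y -> 1 <= norm_l1 (x - y)) ->
  kissing_configuration (cross_polytope R n) S.
Proof.
move=> S1 Ssep; split.
  move=> x y Sx Sy; rewrite !interior_half_translate => -[z [/= zx zy]].
  apply/eqP; apply/negPn/negP => /(Ssep x y Sx Sy).
  have := norm_l1_dist x y z; lra.
move=> x Sx; have x1 := S1 x Sx; split.
  exists (2^-1 *: x); rewrite !half_translateE /=; split.
    rewrite -[X in _ - X]scale1r -scalerBl norm_l1Z x1 mulr1.
    by rewrite ler_norml; apply/andP; split; lra.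
  by rewrite subr0 norm_l1Z x1 mulr1 ger0_norm.
move=> z []; rewrite /boundary half_translateE /= => zx z0.
split; first exact: subset_closure.
rewrite interior_half_translate /= => {}z0.
have := norm_l1_dist x 0 z; rewrite subr0 x1.
lra.
Qed.

Lemma kissing_configuration_norm_le1 (R : realType) n (S : set 'rV[R]_n) x :
  kissing_configuration (cross_polytope R n) S -> S x -> norm_l1 x <= 1.
Proof.
move=> [_ /(_ x) touch] /touch [[z []]].
rewrite !half_translateE /= => zx z0 _.
have := norm_l1_dist x 0 z; rewrite subr0; lra.
Qed.

(** Otherwise the midpoint of x and y lies in both interiors. *)
Lemma kissing_configuration_sep (R : realType) n (S : set 'rV[R]_n) x y :
  kissing_configuration (cross_polytope R n) S -> S x -> S y ->
  norm_l1 (x - y) < 1 -> x = y.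
Proof.
move=> [disj _] Sx Sy xy; apply: disj => //.
exists (2^-1 *: (x + y)); rewrite !interior_half_translate /=; split.
  have -> : 2^-1 *: (x + y) - x = 2^-1 *: - (x - y).
    rewrite opprB -[X in _ - X](scalerK (lt0r_neq0 (ltr0Sn _ 1))) -scalerBr.
    by congr (_ *: _); rewrite scaler_nat mulr2n opprD addrACA subrr add0r.
  by rewrite norm_l1Z norm_l1N ger0_norm // -[ltRHS]mulr1 ltr_pM2l.
have -> : 2^-1 *: (x + y) - y = 2^-1 *: (x - y).
  rewrite -[X in _ - X](scalerK (lt0r_neq0 (ltr0Sn _ 1))) -scalerBr.
  by congr (_ *: _); rewrite scaler_nat mulr2n opprD addrACA subrr addr0.
by rewrite norm_l1Z ger0_norm // -[ltRHS]mulr1 ltr_pM2l.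
Qed.

(** * The kissing number as a maximum *)

Lemma card_eq_setI (T : finType) (C : {set T}) : [set` C] #= `I_#|C|.
Proof.
have finj : {in [set` C] &, injective (index^~ (enum C))}.
  move=> x y; rewrite !in_setE /= => xC yC eq_index.
  by rewrite -[x](@nth_index _ x _ (enum C)) ?eq_index ?nth_index ?mem_enum.
rewrite card_eq_sym; apply: card_eq_trans (inj_card_eq finj).
suff -> : `I_#|C| = [set index x (enum C) | x in [set` C]] by exact: card_eqxx.
apply/seteqP; split=> k /=.
  rewrite cardE => ltk.
  have [x0 _] : exists x0 : T, true.
    by case: (enum C) ltk => // x0; exists x0.
  exists (nth x0 (enum C) k); last by rewrite index_uniq ?enum_uniq.
  by rewrite -mem_enum mem_nth.
by case=> x xC <-; rewrite cardE index_mem mem_enum.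
Qed.

(** The centres lie in [-1, 1]^n; two centres in one cell of the grid of mesh
    1/(n+1) are at l1 distance at most n/(n+1) < 1, hence equal.  So there are
    at most as many centres as cells. *)
Lemma kissing_configuration_card_le (R : realType) n :
  exists N, forall S : set 'rV[R]_n,
    kissing_configuration (cross_polytope R n) S -> S #<= `I_N.
Proof.
pose T := {ffun 'I_n -> 'I_(2 * n.+1).+1}.
exists #|[set: T]%SET| => S Skiss.
pose cell (x : 'rV[R]_n) : T :=
  [ffun i => inord (Num.trunc ((x ord0 i + 1) * n.+1%:R))].
have cell_inj : {in S &, injective cell}.
  move=> x y; rewrite !in_setE => Sx Sy /ffunP xy.
  have trunc_le z i : S z -> 0 <= (z ord0 i + 1) * n.+1%:R /\
      (Num.trunc ((z ord0 i + 1) * n.+1%:R) < (2 * n.+1).+1)%N.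
    move=> Sz; have : `|z ord0 i| <= 1.
      apply: le_trans (kissing_configuration_norm_le1 Skiss Sz).
      by rewrite /norm_l1 (bigD1 i) //= lerDl sumr_ge0.
    rewrite ler_norml => /andP[zl zu].
    have z0 : 0 <= (z ord0 i + 1) * n.+1%:R by rewrite mulr_ge0 //; lra.
    split=> //; rewrite ltnS -(ler_nat R) natrM.
    have /andP[/le_trans -> //] := truncn_itv z0.
    by rewrite ler_pM2r //; lra.
  apply: (kissing_configuration_sep Skiss Sx Sy).
  apply: (@le_lt_trans _ _ (\sum_(i < n) n.+1%:R^-1)); last first.
    rewrite sumr_const card_ord -[ltLHS]mulr_natl ltr_pdivrMr //.
    by rewrite mul1r ltr_nat.
  apply: ler_sum => i _; rewrite !mxE.
  have := xy i; rewrite !ffunE => /(congr1 val).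
  have [x0 xN] := trunc_le x i Sx; have [y0 yN] := trunc_le y i Sy.
  rewrite /= !inordK // => eq_trunc.
  have := truncn_itv x0; have := truncn_itv y0; rewrite eq_trunc.
  set k := Num.trunc _ => /andP[yl yu] /andP[xl xu].
  rewrite -[leRHS]mul1r ler_pdivlMr // -[X in _ * X <= _]ger0_norm // -normrM.
  by rewrite ler_norml; move: xl xu yl yu; rewrite -(natr1 k); nra.
rewrite -(card_le_eqr (card_eq_setI _)).
rewrite -(card_le_eql (inj_card_eq cell_inj)).
by apply: subset_card_le => f _ /=; rewrite finset.in_setT.
Qed.

(** This rests on the maximum defining the kissing number being attained: the
    sizes of the configurations are bounded by the previous lemma. *)
Lemma kissing_number_ge (R : realType) n (S : set 'rV[R]_n) k :
  kissing_configuration (cross_polytope R n) S -> S #= `I_k ->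
  (k <= kissing_number (cross_polytope R n))%N.
Proof.
move=> Skiss Sk; have [N leN] := kissing_configuration_card_le R n.
rewrite /kissing_number; case: xgetP => [K _ [_ maxK]|noK].
  by rewrite -card_le_II -(card_le_eql Sk); apply: maxK.
pose P j := `[< exists S : set 'rV[R]_n,
  kissing_configuration (cross_polytope R n) S /\ S #= `I_j >].
have exP : exists j, P j by exists k; apply/asboolP; exists S.
have ubP j : P j -> (j <= N)%N.
  by move=> /asboolP[S' [/leN + S'j]]; rewrite (card_le_eql S'j) card_le_II.
case: (ex_maxnP exP ubP) => K /asboolP exK maxK.
case: (noK K); split=> // S' S'kiss.
have /finite_setP[j S'j] : finite_set S'.
  by apply/finite_set_leP; exists N; apply: leN.
by rewrite (card_le_eql S'j) card_le_II maxK //; apply/asboolP; exists S'.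
Qed.

(** * From codes to the kissing number *)

Lemma kissing_number_ge_code (R : realType) (A : finType) (pos : A -> int) n m
    (C : {set {ffun 'I_n -> A}}) :
  (0 < m)%N -> {in C, forall x, word_norm pos x = m} ->
  {in C &, forall x y, x != y -> (m <= word_dist pos x y)%N} ->
  (#|C| <= kissing_number (cross_polytope R n))%N.
Proof.
move=> m0 Cwt Cdist.
pose vec (x : {ffun 'I_n -> A}) : 'rV[R]_n :=
  \row_i ((pos (x i))%:~R / m%:R).
have m0R : 0 < m%:R :> R by rewrite ltr0n.
have vec_norm x : norm_l1 (vec x) = (word_norm pos x)%:R / m%:R.
  rewrite natr_sum mulr_suml; apply: eq_bigr => i _.
  by rewrite mxE normrM normfV (gtr0_norm m0R) natr_absz intr_norm.
have vec_dist x y : norm_l1 (vec x - vec y) = (word_dist pos x y)%:R / m%:R.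
  rewrite natr_sum mulr_suml; apply: eq_bigr => i _.
  rewrite !mxE -mulrBl -intrB normrM normfV (gtr0_norm m0R).
  by rewrite natr_absz intr_norm.
have vec_sep x y : x \in C -> y \in C -> x != y -> 1 <= norm_l1 (vec x - vec y).
  move=> xC yC xy; rewrite vec_dist ler_pdivlMr // mul1r ler_nat.
  exact: Cdist.
apply: (@kissing_number_ge R n (vec @` [set` C])).
  apply: kissing_configuration_of_sep => [_ [x /= xC <-]|].
    by rewrite vec_norm Cwt // divff // gt_eqF.
  move=> _ _ [x /= xC <-] [y /= yC <-] xy; apply: vec_sep => //.
  by apply: contra_neq xy => ->.
apply: card_eq_trans (card_eq_setI C); apply: inj_card_eq => x y.
rewrite !in_setE /= => xC yC eq_vec; apply/eqP/negPn/negP.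
move=> /(vec_sep _ _ xC yC).
by rewrite eq_vec subrr norm_l1_0 ler10.
Qed.

Lemma kissing_number_gt0 (R : realType) n :
  (0 < n)%N -> (0 < kissing_number (cross_polytope R n))%N.
Proof.
move=> n0; pose x : 'rV[R]_n := const_mx n%:R^-1.
apply: (@kissing_number_ge R n [set x]); last exact: card_set1.
apply: kissing_configuration_of_sep => [_ ->|_ _ -> ->]; last by rewrite eqxx.
rewrite /norm_l1; under eq_bigr do rewrite mxE.
rewrite sumr_const card_ord ger0_norm ?invr_ge0 // -[LHS]mulr_natr mulVf //.
by rewrite pnatr_eq0 -lt0n.
Qed.

(** Every norm m between 1 and L * n gives a code, whose size bounds the part of
    the expanded n-th power carried by the words of norm m.  The norm 0
    gives no configuration, but its only possible word, repeating the letter of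
    position 0, contributes at most 1, because Z(a) >= w(a). *)
Lemma kissing_number_growth (R : realType) (A : finType) (pos : A -> int)
    (w : A -> R) (t : R) L n :
  injective pos -> (forall a, `|pos a| <= L)%N ->
  (forall a, 0 < w a) -> 0 < t <= 1 -> (0 < n)%N ->
  (\sum_a w a * t ^+ `|pos a|%N / local_weight pos w t a) ^+ n
    <= (L * n).+1%:R * (kissing_number (cross_polytope R n))%:R.
Proof.
move=> pos_inj posL w0 t01 n0; have /andP[t0 t1] := t01.
rewrite -[n in _ ^+ n]card_ord -prodr_const bigA_distr_bigA /=.
have wtL (x : {ffun 'I_n -> A}) : (word_norm pos x < (L * n).+1)%N.
  rewrite ltnS (leq_trans (leq_sum _ (fun i _ => posL (x i)))) //.
  by rewrite sum_nat_const card_ord mulnC.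
rewrite (partition_big
  (fun x : {ffun 'I_n -> A} => Ordinal (wtL x)) xpredT) //=.
rewrite mulr_natl -[X in _ <= _ *+ X]card_ord -sumr_const.
apply: ler_sum => -[m mL] _.
rewrite (eq_bigl (fun x => word_norm pos x == m)) //.
have [->|m0] := posnP m; last first.
  have [C [Cwt Cdist Csum]] := @exists_code R A pos w t n m w0 t01 m0.
  by rewrite (le_trans Csum) // ler_nat; apply: kissing_number_ge_code Cdist.
apply: (@le_trans _ _ 1); last by rewrite ler1n kissing_number_gt0.
have [x /eqP x0|no_x] :=
  pickP (fun x : {ffun 'I_n -> A} => word_norm pos x == 0%N);
  last by rewrite big_pred0.
have pos0 (y : {ffun 'I_n -> A}) i : word_norm pos y = 0%N -> pos (y i) = 0.
  move=> /eqP; rewrite sum_nat_eq0 => /forallP /(_ i).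
  by rewrite absz_eq0 => /eqP.
rewrite (big_pred1 x) => [|y]; last first.
  apply/eqP/eqP => [y0|->//]; apply/ffunP => i; apply: pos_inj.
  by rewrite !pos0.
apply: prodr_ile1 => i _; rewrite pos0 // absz0 expr0 mulr1.
have wZ : w (x i) <= local_weight pos w t (x i).
  rewrite /local_weight (bigD1 (x i)) //= subrr absz0 expr0 mulr1 lerDl.
  by apply: sumr_ge0 => b _; rewrite mulr_ge0 ?exprn_ge0 // ltW.
have Z0 := lt_le_trans (w0 (x i)) wZ.
by rewrite divr_ge0 ?(ltW (w0 _)) ?(ltW Z0) //= ler_pdivrMr // mul1r.
Qed.

(** * Numerical choice and the final bound *)

(** The exponent eps n = (6 / ln c) / sqrt (n + 1) makes c ^ (eps n * n) equal
    to exp (2 y) with y = 3 n / sqrt (n + 1), and exp (2 y) >= y ^ 2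
    = 9 n ^ 2 / (n + 1), which dominates 2 n + 1. *)
Lemma linear_factor_subexponential (R : realType) (c : R) : 1 < c ->
  exists2 eps : nat -> R, eps n @[n --> \oo] --> (0 : R) &
    forall n, (0 < n)%N -> (2 * n).+1%:R <= c `^ (eps n * n%:R).
Proof.
move=> c1; have lnc : 0 < ln c by rewrite ln_gt0.
exists (fun n => 6 / ln c * Num.sqrt (harmonic n)).
  have sqrt0 : Num.sqrt (harmonic n) @[n --> \oo] --> (0 : R).
    rewrite -[X in _ --> X](@sqrtr0 R).
    by apply: continuous_cvg; [exact: sqrt_continuous|exact: cvg_harmonic].
  rewrite -[X in _ --> X](mulr0 (6 / ln c)).
  by apply: cvgM => //; exact: cvg_cst.
move=> n n0; rewrite /powR gt_eqF ?(lt_trans ltr01) //.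
have -> : 6 / ln c * Num.sqrt (harmonic n) * n%:R * ln c =
    3 * n%:R * Num.sqrt (harmonic n) *+ 2.
  by rewrite -mulr_natr; field; rewrite gt_eqF.
set y := 3 * _ * _; rewrite mulr2n expRD -expr2.
have y0 : 0 <= y by rewrite !mulr_ge0 ?sqrtr_ge0.
apply: (@le_trans _ _ (y ^+ 2)); last first.
  rewrite lerXn2r ?nnegrE ?expR_ge0 //.
  by apply: le_trans (expR_ge1Dx _); rewrite lerDr.
rewrite exprMn sqr_sqrtr ?invr_ge0 // ler_pdivlMr //.
rewrite -!natrM -natrX ler_nat; nia.
Qed.

Definition letter (a : 'I_5) : int := (a : nat)%:Z - 2%:Z.

Lemma letter_inj : injective letter.
Proof. by move=> a b /addIr [] /val_inj. Qed.

Lemma letter_le2 a : (`|letter a| <= 2)%N.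
Proof. by rewrite /letter; have := ltn_ord a; lia. Qed.

(** Simple integers close to the optimal weights for five letters, which
    numerically are proportional to 3.7, 1, 0.8 at the positions 0, 1, 2, with
    t = 0.38, and give the rate 1.1803. *)
Definition letter_weight (R : realFieldType) (a : 'I_5) : R :=
  if (a : nat) == 2%N then 4 else 1.

Lemma letter_weight_gt0 (R : realFieldType) a : 0 < letter_weight R a.
Proof. by rewrite /letter_weight; case: ifP. Qed.

Lemma letter_rate (R : realFieldType) :
  11637 / 10000 <=
  \sum_a letter_weight R a * 2^-1 ^+ `|letter a|%N
            / local_weight letter (letter_weight R) 2^-1 a.
Proof.
have Z k (lt5 : (k < 5)%N) :
    local_weight letter (letter_weight R) 2^-1 (Ordinal lt5) =
    nth 0 [:: 43 / 16; 31 / 8; 11 / 2; 31 / 8; 43 / 16] k.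
  rewrite /local_weight !big_ord_recl big_ord0 /letter_weight /letter /=.
  by case: k lt5 => [|[|[|[|[|//]]]]] _;
    rewrite /bump /absz /= ?exprS ?expr0; field.
rewrite (eq_bigr (fun a : 'I_5 => letter_weight R a * 2^-1 ^+ `|letter a|%N /
  nth 0 [:: 43 / 16; 31 / 8; 11 / 2; 31 / 8; 43 / 16] a)); last first.
  by case=> k lt5 _; rewrite Z.
rewrite !big_ord_recl big_ord0 /letter_weight /letter /= /bump /=.
lra.
Qed.

Theorem theorem4 (R : realType) :
  exists eps : nat -> R,
    eps n @[n --> \oo] --> (0 : R) /\
    forall n : nat, (1 <= n)%N ->
      (11637 / 10000 : R) `^ ((1 - eps n) * n%:R)
        <= (kissing_number (cross_polytope R n))%:R.
Proof.
have c1 : 1 < 11637 / 10000 :> R by lra.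
have [eps eps0 epsP] := linear_factor_subexponential c1.
exists eps; split=> // n n0.
have c0 := lt_trans ltr01 c1.
rewrite mulrBl mul1r powRB ?(gt_eqF c0) ?implybT //.
rewrite powR_mulrn ?(ltW c0) // ler_pdivrMr ?powR_gt0 //.
have t01 : 0 < (2^-1 : R) <= 1 by rewrite invr_gt0 ltr0n invf_le1 ?ler1n ?ltr0n.
have := kissing_number_growth letter_inj letter_le2
  (@letter_weight_gt0 R) t01 n0.
move: (letter_rate R); set base := \sum_a _; move: base => base rate growth.
apply: (@le_trans _ _ (base ^+ n)).
  have base0 := le_trans (ltW c0) rate.
  by apply: lerXn2r => //; rewrite nnegrE ltW.
apply: le_trans growth _; rewrite mulrC ler_wpM2l //; exact: epsP.
Qed.
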